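(* Let $\lambda>0$ be a constant and let $\{m=m(n)\}_{n}$ be a sequence of nonnegative integers, $m(n)\in\{0,\ldots,n-1\}$, such that $m\to\infty$ and $\frac{n-m}{\sqrt n}\to\sqrt{2\lambda}$ as $n\to\infty$. Put $$\lambda_n=\sum_{i=m+1}^n\left(1-\frac in\right),\qquad\lambda_{n,2}=\sum_{i=m+1}^n\left(1-\frac in\right)^2.$$ Then, as $n\to\infty$, $$\mathbf P(\widetilde W_{n,m}=0)=e^{-\lambda_n}-e^{-\lambda_n}\frac{\lambda_{n,2}}2+O\!\left(\frac1n\right),$$ $$\mathbf P(\widetilde W_{n,m}=1)=e^{-\lambda_n}\lambda_n-e^{-\lambda_n}\lambda_n\frac{\lambda_{n,2}}2+O\!\left(\frac1n\right),$$ and for every fixed integer $k\ge2$, $$\mathbf P(\widetilde W_{n,m}=k)=e^{-\lambda_n}\frac{\lambda_n^k}{k!}+e^{-\lambda_n}\left(\frac{\lambda_n^{k-2}}{(k-2)!}-\frac{\lambda_n^k}{k!}\right)\frac{\lambda_{n,2}}2+O\!\left(\frac1n\right).$$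
   Context: Coupon collector's waiting time: coupons are drawn independently and uniformly at random with replacement from $n\ge2$ distinct coupons, and $W_{n,m}$ is the number of draws until $n-m$ distinct coupons have been collected for the first time. The shifted waiting time is $\widetilde W_{n,m}=W_{n,m}-(n-m)$; equivalently it is distributed as $\sum_{i=m+1}^n\widetilde X_{n,i}$ with independent $\widetilde X_{n,i}$ satisfying $\mathbf P(\widetilde X_{n,i}=j)=(1-\frac in)^j\frac in$, $j=0,1,2,\ldots$. *)

(* Defs.v *)
From mathcomp Require Import all_boot all_order all_algebra.
From mathcomp Require Import all_classical all_reals all_analysis.

Set Implicit Arguments.
Unset Strict Implicit.
Unset Printing Implicit Defensive.

Import Order.TTheory GRing.Theory Num.Theory.
Import numFieldNormedType.Exports.

Local Open Scope classical_set_scope.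
Local Open Scope ring_scope.

Definition mutually_independent (R : realType) (d d' : measure_display)
    (T : measurableType d) (T' : measurableType d') (P : probability T R)
    (X : nat -> {RV P >-> T'}) : Prop :=
  forall (J : seq nat) (B : nat -> set T'),
    uniq J -> (forall i, measurable (B i)) ->
    P (\bigcap_(i in [set` J]) X i @^-1` B i) =
      (\prod_(i <- J) P (X i @^-1` B i))%E.

(* The coupons are labelled 0, ..., n - 1.  Labels live in nat rather than in
   'I_n, so that a family of draws indexed by all n : nat exists ('I_0 would
   leave no room for draws at n = 0).  The point masses sum to 1 over c < n,
   hence almost surely every draw is a label below n. *)
Definition coupon_draws (n : nat) (R : realType) (d : measure_display)
    (T : measurableType d) (P : probability T R)
    (X : nat -> {RV P >-> nat}) : Prop :=
  mutually_independent X /\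
  (forall i c, (c < n)%N -> P (X i @^-1` [set c]) = (n%:R^-1)%:E).

Definition nb_collected (T : Type) (X : nat -> T -> nat) (t : nat) (w : T)
  : nat := size (undup [seq X i w | i <- iota 0 t]).

(* Extended-real valued: the infimum of the empty set is +oo, which is the
   value on the (null) event that r distinct coupons never appear. *)
Definition waiting_time (R : realType) (T : Type) (X : nat -> T -> nat)
    (r : nat) (w : T) : \bar R :=
  ereal_inf [set t%:R%:E | t in [set t | nb_collected X t w = r]].

Definition shifted_waiting_time (R : realType) (T : Type)
    (X : nat -> T -> nat) (r : nat) (w : T) : \bar R :=
  (waiting_time R X r w - r%:R%:E)%E.

(* Main.v *)
Require Import Defs.
From mathcomp Require Import all_boot all_order all_algebra.
From mathcomp Require Import all_classical all_reals all_analysis.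
From mathcomp Require Import ring lra zify.

Set Implicit Arguments.
Unset Strict Implicit.
Unset Printing Implicit Defensive.

Import Order.TTheory GRing.Theory Num.Theory.
Import numFieldNormedType.Exports.

Local Open Scope classical_set_scope.
Local Open Scope ring_scope.

(* Let x_i = i / n and r = n - m.  Running the occupancy recursion shows that
   the shifted waiting time equals k with probability
     (1 - x_0) ... (1 - x_(r-1)) * h_k(x_0, ..., x_(r-1)),
   where h_k is the complete homogeneous symmetric polynomial.  With p_j the
   power sums of the x_i, lambda_n = p_1 and lambda_(n,2) = p_2; since
   r = O(sqrt n), p_1 = O(1), p_2 ^ 2 = O(1/n) and p_j = O(1/n) for j >= 3.
   Hence the product is e^(- p_1) (1 - p_2 / 2) + O(1/n), and Newton's identities
   give h_k = p_1^k / k! + p_1^(k-2) / (k-2)! * p_2 / 2 + O(1/n) by induction. *)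

(** * Complete homogeneous symmetric polynomials *)

Section Newton.
Variable R : realFieldType.

(* The complete homogeneous symmetric polynomial of degree k in
   x 0, ..., x r.-1: i is the largest index occurring in a monomial. *)
Fixpoint hsym (x : nat -> R) (k r : nat) : R :=
  if k is k'.+1 then \sum_(i < r) x i * hsym x k' i.+1 else 1.

Arguments hsym : simpl never.

Definition psum (x : nat -> R) (j r : nat) : R := \sum_(i < r) x i ^+ j.

Lemma psum1 (x : nat -> R) (r : nat) : psum x 1 r = \sum_(i < r) x i.
Proof. by apply: eq_bigr => i _; rewrite expr1. Qed.

Lemma hsymS (x : nat -> R) (k r : nat) :
  hsym x k.+1 r.+1 = hsym x k.+1 r + x r * hsym x k r.+1.
Proof. by rewrite {1}/hsym big_ord_recr. Qed.

Lemma hsym0 (x : nat -> R) (k : nat) : hsym x k.+1 0 = 0.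
Proof. by rewrite /hsym big_ord0. Qed.

(** Monomials are sorted by their exponent in the last variable [x r]. *)
Lemma hsym_step_sum (x : nat -> R) (k r : nat) :
  \sum_(i < k.+1) x r ^+ i * hsym x (k - i) r = hsym x k r.+1.
Proof.
elim: k => [|k IH]; first by rewrite big_ord1 mulr1.
rewrite big_ord_recl expr0 mul1r subn0 hsymS -IH mulr_sumr; congr (_ + _).
by apply: eq_bigr => i _; rewrite lift0 exprS mulrA subSS.
Qed.

(** Newton's identity, by induction on the number of variables and then on the degree. *)
Lemma newton_hsym (x : nat -> R) (k r : nat) :
  k.+1%:R * hsym x k.+1 r = \sum_(i < k.+1) psum x i.+1 r * hsym x (k - i) r.
Proof.
elim: r k => [|r IHr] k.
  by rewrite hsym0 mulr0 big1 // => i _; rewrite /psum big_ord0 mul0r.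
elim: k => [|k IHk].
  have := IHr 0%N; rewrite !big_ord1 !mul1r hsymS => ->.
  by rewrite /psum big_ord_recr /= !mulr1 expr1.
(* Once summed over [i], the three summands are handled by [IHr], [hsym_step_sum] and [IHk]. The
   last one is absent at [i = k.+1], where the factor [hsym] has degree 0 and [hsymS] does not
   apply. *)
have step i : (i < k.+2)%N -> psum x i.+1 r.+1 * hsym x (k.+1 - i) r.+1 =
    psum x i.+1 r * hsym x (k.+1 - i) r
    + x r * (x r ^+ i * hsym x (k.+1 - i) r)
    + x r * (if (i < k.+1)%N then psum x i.+1 r.+1 * hsym x (k - i) r.+1 else 0).
  move=> ik; case: ltnP => [ik'|ki].
    rewrite subSn // hsymS /psum big_ord_recr /= exprS; ring.
  have -> : i = k.+1 by lia.
  rewrite subnn /psum big_ord_recr /= exprS; ring.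
rewrite (eq_bigr _ (fun (i : 'I_k.+2) _ => step i (ltn_ord i))) !big_split /=.
rewrite -IHr -!mulr_sumr hsym_step_sum big_ord_recr /= ltnn addr0.
under eq_bigr => i _ do rewrite ltn_ord.
rewrite -IHk hsymS -[k.+2%:R]natr1 -[in RHS]natr1; ring.
Qed.
End Newton.

(** * The law of the shifted waiting time *)

Definition first_draws (T : Type) (X : nat -> T -> nat) (t : nat) (w : T) :
  seq nat := [seq X i w | i <- iota 0 t].

Lemma first_drawsS (T : Type) (X : nat -> T -> nat) (t : nat) (w : T) :
  first_draws X t.+1 w = rcons (first_draws X t w) (X t w).
Proof. by rewrite /first_draws -addn1 iotaD map_cat cats1 add0n. Qed.

(** * Law of a finite block of draws *)

Section Draws.
Context (R : realType) (d : measure_display) (T : measurableType d).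
Variable P : probability T R.

Lemma measurable_preimage_nat (Y : {RV P >-> nat}) (B : set nat) :
  measurable (Y @^-1` B).
Proof. by rewrite -[_ @^-1` _]setTI; exact: measurable_funP. Qed.

(** The [n] point masses already add up to 1, so the part of [E] where [Y] is at least [n] is
    null. *)
Lemma total_mass_partition (Y : {RV P >-> nat}) (n : nat) (E : set T) :
  (0 < n)%N -> (forall c, (c < n)%N -> P (Y @^-1` [set c]) = (n%:R^-1)%:E) ->
  measurable E ->
  P E = (\sum_(c < n) P (E `&` Y @^-1` [set nat_of_ord c]))%E.
Proof.
move=> n0 PY mE.
have mY c := measurable_preimage_nat Y [set c].
have tY : trivIset [set: 'I_n] (fun c : 'I_n => Y @^-1` [set nat_of_ord c]).
  by move=> i j _ _ [w [/= wi wj]]; apply: val_inj; exact: etrans (esym wi) wj.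
pose G := \big[setU/set0]_(c < n) (Y @^-1` [set nat_of_ord c]).
have mG : measurable G by apply: bigsetU_measurable => c _; exact: mY.
have PG : P G = 1%E.
  rewrite /G measure_bigsetU_ord //.
  rewrite (eq_bigr (fun=> (n%:R^-1)%:E)); last by move=> c _; exact: PY.
  rewrite sumEFin sumr_const card_ord -(mulr_natl n%:R^-1) mulfV //.
  by rewrite pnatr_eq0 -lt0n.
have PCG : P (~` G) = 0%E by rewrite probability_setC // PG subee.
have PEG : P (E `\` G) = 0%E.
  by apply: subset_measure0 PCG => //; [exact: measurableD | exact: measurableC].
rewrite -{1}(setUIDK E G) measureU0 //; last 2 first.
- exact: measurableI.
- exact: measurableD.
rewrite /G big_distrr /= measure_bigsetU_ord //.
- by move=> i; apply: measurableI.
- exact: trivIset_setIl tY.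
Qed.

Fixpoint words (n t : nat) : seq (seq nat) :=
  if t is t'.+1 then [seq rcons s c | s <- words n t', c <- iota 0 n]
  else [:: [::]].

Lemma words_subset (n t : nat) (s : seq nat) :
  s \in words n t -> size s = t /\ {subset s <= iota 0 n}.
Proof.
elim: t s => [|t IH] s /=; first by rewrite inE => /eqP ->.
move=> /allpairsP[[s' c] /= [/IH[<- sn] cn ->]].
rewrite size_rcons; split => // x; rewrite mem_rcons inE => /predU1P[->//|].
exact: sn.
Qed.

(** The event is a countable union over the value of the last draw. Fixing that value changes the
    predicate, so the induction is over all [phi]. *)
Lemma measurable_first_draws (X : nat -> {RV P >-> nat}) (t : nat)
    (phi : pred (seq nat)) : measurable [set w | phi (first_draws X t w)].
Proof.
elim: t phi => [|t IH] phi.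
  rewrite /first_draws /=; case: (phi [::]).
    by rewrite (_ : [set _ | _] = setT) //; apply/seteqP.
  by rewrite (_ : [set _ | _] = set0) //; apply/seteqP; split.
rewrite (_ : [set _ | _] = \bigcup_c
    (X t @^-1` [set c] `&` [set w | phi (rcons (first_draws X t w) c)])).
  apply: bigcup_measurable => c _; apply: measurableI.
    exact: measurable_preimage_nat.
  exact: (IH (fun s => phi (rcons s c))).
apply/seteqP; split => w /=; rewrite first_drawsS; first by exists (X t w).
by move=> [c _ [/= <-]].
Qed.

Section Coupon.
Variables (n : nat) (X : nat -> {RV P >-> nat}).
Hypothesis n0 : (0 < n)%N.
Hypothesis hX : coupon_draws n X.

Lemma first_draws_word (t : nat) (s : seq nat) : s \in words n t ->
  P [set w | first_draws X t w = s] = (n%:R^-1 ^+ t)%:E.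
Proof.
case: hX => indep unif /words_subset [<- sn].
have -> : [set w | first_draws X (size s) w = s] =
    \bigcap_(i in [set` iota 0 (size s)]) X i @^-1` [set nth 0%N s i].
  apply/seteqP; split => w /=.
    move=> E i /=; rewrite mem_iota add0n => /andP[_ i_s].
    by rewrite -E (nth_map 0%N) ?size_iota // nth_iota.
  move=> E; apply: (@eq_from_nth _ 0%N); rewrite /first_draws size_map size_iota //.
  move=> i i_s; rewrite (nth_map 0%N) ?size_iota // nth_iota // add0n.
  by apply: E; rewrite /= mem_iota.
rewrite indep ?iota_uniq //.
rewrite (eq_big_seq (fun=> (n%:R^-1)%:E)).
  by rewrite prodEFin big_const_seq count_predT size_iota iter_mulr_1.
move=> i; rewrite mem_iota => /andP[_ i_s]; apply: unif.
have : nth 0%N s i \in iota 0 n by apply/sn/mem_nth.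
by rewrite mem_iota.
Qed.

Lemma first_draws_partition (t : nat) (E : set T) : measurable E ->
  P E = (\sum_(s <- words n t) P (E `&` [set w | first_draws X t w = s]))%E.
Proof.
move=> mE; elim: t => [|t IH].
  by rewrite big_seq1 (_ : [set w | _] = setT) ?setIT //; apply/seteqP.
rewrite IH [words _ _]/= big_allpairs_dep; apply: eq_bigr => s _.
rewrite (@total_mass_partition (X t) n) //; last first.
- apply: measurableI => //.
  have := measurable_first_draws X t (pred1 s).
  by congr measurable; apply/seteqP; split => w /= /eqP.
- exact: hX.2.
rewrite -(big_mkord xpredT (fun c => P (_ `&` X t @^-1` [set c]))).
rewrite /index_iota subn0; apply: eq_bigr => c _.
rewrite -setIA; congr (P (_ `&` _)); apply/seteqP; split => w /=.
  by move=> [<- <-]; rewrite first_drawsS.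
by rewrite first_drawsS => /rcons_inj [].
Qed.

(** From here on, an event decided by the first [t] draws is a matter of counting words. *)
Lemma first_draws_law (t : nat) (phi : pred (seq nat)) :
  P [set w | phi (first_draws X t w)] =
    (\sum_(s <- words n t) (phi s)%:R * n%:R^-1 ^+ t)%:E.
Proof.
rewrite (first_draws_partition t (measurable_first_draws X t phi)) -sumEFin.
apply: eq_big_seq => s sw; case: (boolP (phi s)) => ps.
  rewrite mul1r -(first_draws_word sw); congr (P _).
  by apply/seteqP; split => w /= [] // ->.
rewrite mul0r (_ : _ `&` _ = set0) ?measure0 //.
by apply/seteqP; split => w //= [] + E; rewrite E (negbTE ps).
Qed.

End Coupon.
End Draws.

(** * Occupancy probabilities by counting words *)

Section Counting.
Context (R : realType).
Implicit Types (n t j k c : nat) (s : seq nat).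

Lemma size_undup_rcons s c :
  size (undup (rcons s c)) = (size (undup s) + (c \notin s))%N.
Proof.
rewrite (perm_size (perm_undup (perm_mem _ : _ =i c :: s))) /=.
  by case: (c \in s); rewrite /= ?addn0 ?addn1.
by rewrite perm_rcons.
Qed.

Lemma count_collected n s : {subset s <= iota 0 n} ->
  count (mem s) (iota 0 n) = size (undup s).
Proof.
move=> sn; rewrite -size_filter; apply/perm_size/uniq_perm.
- by rewrite filter_uniq ?iota_uniq.
- exact: undup_uniq.
- move=> x; rewrite mem_filter mem_undup -[mem s x]/(x \in s).
  by case: (boolP (x \in s)) => [/sn ->|].
Qed.

(** A word with [j.+1] distinct letters keeps that number if the new letter is one of these [j.+1];
    a word with [j] reaches it through one of the [n - j] missing letters. *)
Lemma sum_extend n s j : {subset s <= iota 0 n} ->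
  \sum_(c <- iota 0 n) (size (undup (rcons s c)) == j.+1)%:R =
    (size (undup s) == j.+1)%:R * j.+1%:R
    + (size (undup s) == j)%:R * (n%:R - j%:R) :> R.
Proof.
move=> sn.
have -> : \sum_(c <- iota 0 n) (size (undup (rcons s c)) == j.+1)%:R =
    \sum_(c <- iota 0 n) ((size (undup s) == j.+1)%:R * (c \in s)%:R
       + (size (undup s) == j)%:R * (1 - (c \in s)%:R)) :> R.
  apply: eq_bigr => c _; rewrite size_undup_rcons.
  case: (c \in s); rewrite /= ?addn0 ?addn1 ?eqSS; ring.
have E : \sum_(c <- iota 0 n) (c \in s)%:R = (size (undup s))%:R :> R.
  by rewrite -natr_sum -(count_collected sn) -sum1_count [in RHS]big_mkcond.
rewrite big_split /= -!mulr_sumr sumrB E big_const_seq count_predT size_iota.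
rewrite iter_addr_0; congr (_ + _).
  by case: eqP => [->|]; rewrite ?mul0r.
by case: eqP => [->|]; rewrite ?mul0r.
Qed.

(* The probability that t uniform draws from n labels show exactly j of them. *)
Definition occupancy n t j : R :=
  \sum_(s <- words n t) (size (undup s) == j)%:R * n%:R^-1 ^+ t.

Lemma occupancyS n t j : (0 < n)%N ->
  occupancy n t.+1 j.+1 =
    occupancy n t j.+1 * (j.+1%:R / n%:R) + occupancy n t j * (1 - j%:R / n%:R).
Proof.
move=> n0; rewrite /occupancy [words _ _]/= big_allpairs_dep !mulr_suml -big_split /=.
apply: eq_big_seq => s /words_subset[_ sn].
rewrite -mulr_suml sum_extend // exprS.
have : n%:R != 0 :> R by rewrite pnatr_eq0 -lt0n.
by move=> nz; field.
Qed.

Lemma occupancy_gt n t j : (t < j)%N -> occupancy n t j = 0.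
Proof.
move=> tj; rewrite /occupancy big_seq big1 // => s /words_subset[st _].
by rewrite ltn_eqF ?mul0r //; apply: leq_ltn_trans (size_undup s) _; rewrite st.
Qed.

Lemma occupancy_base n k : occupancy n k 0 = (k == 0%N)%:R.
Proof.
case: k => [|k]; first by rewrite /occupancy big_seq1 expr0 mulr1.
rewrite /occupancy big_seq big1 // => s /words_subset[+ _].
case: s => // c s _; rewrite (_ : _ == _ = false) ?mul0r //.
apply/negbTE; rewrite -lt0n -has_predT; apply/hasP; exists c => //.
by rewrite mem_undup mem_head.
Qed.

(** Here [k] counts the repeated draws. A repetition made while [i] labels are present costs a
    factor [x i], and [i] runs up to [j] included, whence [j.+1] variables. Formally, [occupancyS]
    follows the recursion [hsymS]. *)
Lemma occupancy_hsym n j k : (0 < n)%N ->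
  let x i : R := i%:R / n%:R in
  occupancy n (j + k) j = (\prod_(i < j) (1 - x i)) * hsym x k j.+1.
Proof.
move=> n0 x; elim: j k => [|j IHj] k.
  rewrite add0n occupancy_base big_ord0 mul1r; case: k => [|k] //.
  by rewrite hsymS hsym0 /x !mul0r addr0.
elim: k => [|k IHk].
  have := IHj 0%N; rewrite !addn0 occupancyS // (occupancy_gt _ (ltnSn j)).
  rewrite mul0r add0r => ->.
  by rewrite big_ord_recr /= !mulr1.
have -> : (j.+1 + k.+1 = (j.+1 + k).+1)%N by rewrite addnS.
rewrite occupancyS // IHk addSnnS IHj big_ord_recr (hsymS x k j.+1) /= -/(x j) -/(x j.+1).
ring.
Qed.
End Counting.

(** * Waiting times in terms of the number of distinct coupons *)

Section WaitingTime.
Context (R : realType) (T : Type) (X : nat -> T -> nat) (w : T).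
Implicit Types t r : nat.

Lemma nb_collectedS t :
  nb_collected X t.+1 w =
    (nb_collected X t w + (X t w \notin first_draws X t w))%N.
Proof.
by rewrite /nb_collected -/(first_draws X t.+1 w) first_drawsS size_undup_rcons.
Qed.

Lemma nb_collected_homo t t' : (t <= t')%N ->
  (nb_collected X t w <= nb_collected X t' w)%N.
Proof.
move=> /subnKC <-; elim: (t' - t)%N => [|u IH]; first by rewrite addn0.
by rewrite addnS nb_collectedS (leq_trans IH) // leq_addr.
Qed.

(** A nonempty set of draw numbers has a least element, which is its infimum; the empty set gives
    [+oo], which differs from every [t]. *)
Lemma waiting_time_eqP t r :
  waiting_time R X r w = t%:R%:E <->
  nb_collected X t w = r /\ forall u, (u < t)%N -> nb_collected X u w <> r.
Proof.
have first_time v : nb_collected X v w = r ->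
    (forall u, (u < v)%N -> nb_collected X u w <> r) ->
    waiting_time R X r w = v%:R%:E.
  move=> nbv before; apply/eqP; rewrite eq_le; apply/andP; split.
    by apply: ereal_inf_lbound; exists v.
  apply: le_ereal_inf_tmp => _ [u /= nbu <-]; rewrite lee_fin ler_nat leqNgt.
  by apply/negP => /before.
split=> [wt|[nbt before]]; last exact: first_time.
have [[v nbv]|none] := pselect (exists v, nb_collected X v w == r).
  case: (@ex_minnP (fun v => nb_collected X v w == r) (ex_intro _ v nbv)) => u /eqP nbu umin.
  have before z : (z < u)%N -> nb_collected X z w <> r.
    by move=> zu /eqP /umin; rewrite leqNgt zu.
  have := first_time u nbu before; rewrite wt => -[/eqP].
  by rewrite eqr_nat => /eqP ->.
move: wt; rewrite /waiting_time (_ : [set _ | _] = set0) ?image_set0 ?ereal_inf0 //.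
by apply/seteqP; split => // v /= /eqP nbv; apply: none; exists v.
Qed.

(** The count is nondecreasing and grows by at most one per draw, so two consecutive counts
    determine the first time it reaches [r.+1]. *)
Lemma shifted_waiting_time_eqP r k :
  shifted_waiting_time R X r.+1 w = k%:R%:E <->
  nb_collected X (r + k).+1 w = r.+1 /\ nb_collected X (r + k) w = r.
Proof.
have -> : shifted_waiting_time R X r.+1 w = k%:R%:E <->
    waiting_time R X r.+1 w = (r + k).+1%:R%:E.
  rewrite /shifted_waiting_time; case: waiting_time => [u| |] //=.
  rewrite -addSn natrD; split=> -[E]; congr EFin; lra.
rewrite waiting_time_eqP; split=> -[nb1 nb2]; split => //.
  have := nb2 _ (ltnSn _); move: nb1; rewrite nb_collectedS.
  by case: (_ \notin _); rewrite ?addn1 ?addn0 // => -[].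
move=> u; rewrite ltnS => /nb_collected_homo; rewrite nb2 => + E.
by rewrite E ltnn.
Qed.
End WaitingTime.

Section Law.
Context (R : realType) (d : measure_display) (T : measurableType d).
Variable P : probability T R.

Lemma shifted_waiting_time_law (n : nat) (X : nat -> {RV P >-> nat})
    (r k : nat) :
  (0 < n)%N -> (0 < r)%N -> coupon_draws n X ->
  let x i : R := i%:R / n%:R in
  fine (P [set w | shifted_waiting_time R X r w = k%:R%:E]) =
    (\prod_(i < r) (1 - x i)) * hsym x k r.
Proof.
case: r => // r n0 _ hX x.
(* Both counts are read off one word of length [(r + k).+1]; [take] drops its last letter. *)
pose phi (s : seq nat) := (size (undup s) == r.+1)
  && (size (undup (take (r + k) s)) == r).
have -> : [set w | shifted_waiting_time R X r.+1 w = k%:R%:E] =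
    [set w | phi (first_draws X (r + k).+1 w)].
  apply/seteqP; split => w /=.
    move=> /shifted_waiting_time_eqP [nb1 nb2]; rewrite /phi -/(nb_collected X _ w).
    rewrite nb1 first_drawsS -cats1 take_size_cat ?size_map ?size_iota //.
    by rewrite -/(nb_collected X _ w) nb2 !eqxx.
  rewrite /phi => /andP[nb1 nb2]; apply/shifted_waiting_time_eqP.
  split; first exact/eqP.
  move: nb2; rewrite first_drawsS -cats1 take_size_cat ?size_map ?size_iota //.
  by move/eqP.
rewrite (first_draws_law n0 hX) /= big_allpairs_dep big_ord_recr /= mulrAC.
rewrite -(occupancy_hsym R r k n0) /occupancy mulr_suml.
apply: eq_big_seq => s /words_subset[ss sn].
have nz : n%:R != 0 :> R by rewrite pnatr_eq0 -lt0n.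
(* Summing over the last letter, which must be new, yields the factor [1 - x r] on top of the
   occupancy probability. *)
transitivity ((size (undup s) == r)%:R *
    (\sum_(c <- iota 0 n) (size (undup (rcons s c)) == r.+1)%:R) *
    n%:R^-1 ^+ (r + k).+1 : R).
  rewrite mulr_sumr mulr_suml; apply: eq_bigr => c _; congr (_ * _).
  by rewrite /phi -cats1 take_size_cat // -mulnb natrM mulrC.
rewrite sum_extend // exprS.
case: (size (undup s) =P r) => [->|]; last by rewrite !mul0r.
rewrite (_ : (r == r.+1) = false) ?ltn_eqF // /x /=; field.
by [].
Qed.
End Law.

(** * Asymptotic expansion *)

Section OneMinus.
Context (R : realType).

Lemma one_minus_le_expR (x : R) : 0 <= x -> 1 - x <= expR (- (x + x ^+ 2 / 2)).
Proof.
move=> x0.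
(* The derivative has the sign of [(1 + y) * (1 - y) - 1 = - y ^+ 2], so [f] decreases from
   [f 0 = 1]. *)
pose f (y : R) := expR (y + y ^+ 2 / 2) * (1 - y).
have df (y : R) : is_derive y 1 f (- (y ^+ 2 * expR (y + y ^+ 2 / 2))).
  by rewrite /f; apply: is_derive_eq; rewrite /GRing.scale /=; field.
have cf : {within `[0, x], continuous f}.
  by apply: derivable_within_continuous => y _; apply: ex_derive.
have : f x <= f 0.
  apply: (@ler0_derive1_le_cc R f 0 x) => //; rewrite ?in_itv /= ?lexx ?x0 //.
  move=> y _; rewrite derive1E (@derive_val _ _ _ _ _ _ _ (df y)).
  by rewrite oppr_le0 mulr_ge0 ?expR_ge0 ?sqr_ge0.
rewrite /f expr0n mul0r addr0 expR0 subr0 mulr1 expRN.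
by rewrite -ler_pdivlMl ?expR_gt0 // mulr1.
Qed.

Lemma expR_le_one_minus (x : R) : 0 <= x -> x <= 2 / 3 ->
  expR (- (x + x ^+ 2 / 2 + x ^+ 3)) <= 1 - x.
Proof.
move=> x0 x23.
(* Now the derivative has the sign of [2 - 3 * y], which is where the bound 2/3 comes from. *)
pose f (y : R) := expR (y + y ^+ 2 / 2 + y ^+ 3) * (1 - y).
have df (y : R) :
    is_derive y 1 f (y ^+ 2 * (2 - 3 * y) * expR (y + y ^+ 2 / 2 + y ^+ 3)).
  by rewrite /f; apply: is_derive_eq; rewrite /GRing.scale /=; field.
have cf : {within `[0, x], continuous f}.
  by apply: derivable_within_continuous => y _; apply: ex_derive.
have : f 0 <= f x.
  apply: (@ger0_derive1_le_cc R f 0 x) => //; rewrite ?in_itv /= ?lexx ?x0 //.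
  move=> y; rewrite in_itv /= => /andP[y0 yx].
  rewrite derive1E (@derive_val _ _ _ _ _ _ _ (df y)).
  by rewrite !mulr_ge0 ?expR_ge0 ?sqr_ge0 //; lra.
rewrite /f !expr0n /= mul0r !addr0 expR0 subr0 mulr1 expRN.
by rewrite -ler_pdivrMl ?expR_gt0 // mulr1.
Qed.

Lemma prod_one_minus_bounds (x : nat -> R) (r : nat) :
  (forall i, (i < r)%N -> 0 <= x i <= 2 / 3) ->
  expR (- (psum x 1 r + psum x 2 r / 2 + psum x 3 r))
    <= \prod_(i < r) (1 - x i) <= expR (- (psum x 1 r + psum x 2 r / 2)).
Proof.
move=> hx; rewrite /psum; elim: r hx => [|r IH] hx.
  by rewrite !big_ord0 mul0r !addr0 oppr0 expR0 lexx.
have /andP[lo up] := IH (fun i ir => hx i (ltnW ir)).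
have /andP[x0 x1] := hx r (ltnSn r).
rewrite !big_ord_recr /= expr1; apply/andP; split.
  rewrite [X in expR X](_ : _ = - (\sum_(i < r) x i ^+ 1 + (\sum_(i < r) x i ^+ 2) / 2
    + \sum_(i < r) x i ^+ 3) - (x r + x r ^+ 2 / 2 + x r ^+ 3)); last by field.
  by rewrite expRD ler_pM ?expR_ge0 // expR_le_one_minus.
rewrite [X in expR X](_ : _ = - (\sum_(i < r) x i ^+ 1 + (\sum_(i < r) x i ^+ 2) / 2)
   - (x r + x r ^+ 2 / 2)); last by field.
rewrite expRD ler_pM ?one_minus_le_expR //; last lra.
by apply: le_trans lo; rewrite expR_ge0.
Qed.

Lemma prod_one_minus_approx (x : nat -> R) (r : nat) :
  (forall i, (i < r)%N -> 0 <= x i <= 2 / 3) ->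
  `|\prod_(i < r) (1 - x i)
      - expR (- psum x 1 r) * (1 - psum x 2 r / 2)|
    <= psum x 3 r + psum x 2 r ^+ 2.
Proof.
move=> hx; have /andP[] := prod_one_minus_bounds hx.
have p_ge0 j : 0 <= psum x j r.
  by apply: sumr_ge0 => i _; apply/exprn_ge0; have /andP[] := hx i (ltn_ord i).
have := p_ge0 1%N; have := p_ge0 2%N; have := p_ge0 3%N.
move: (psum x 1 r) (psum x 2 r) (psum x 3 r) (\prod_(i < r) _).
move=> a b c q c0 b0 a0.
rewrite (_ : - (a + b / 2 + c) = - a + (- (b / 2) - c)); last by ring.
rewrite (_ : - (a + b / 2) = - a - b / 2); last by ring.
rewrite !(expRD (- a)).
have e0 := expR_gt0 (- a); have e1 : expR (- a) <= 1 by rewrite -expR0 ler_expR; lra.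
have lo := expR_ge1Dx (- (b / 2) - c).
(* Follows from [1 + b / 2 <= expR (b / 2)], because [(1 - b / 2 + b ^+ 2) * (1 + b / 2)] equals
   [1 + 3 / 4 * b ^+ 2 + b ^+ 3 / 2]. *)
have up : expR (- (b / 2)) <= 1 - b / 2 + b ^+ 2.
  rewrite expRN -div1r ler_pdivrMr ?expR_gt0 //.
  apply: le_trans (_ : (1 - b / 2 + b ^+ 2) * (1 + b / 2) <= _); first nra.
  by apply: ler_wpM2l; [nra | exact: expR_ge1Dx].
move=> hlo hup.
have {}hlo := le_trans (ler_wpM2l (ltW e0) lo) hlo.
have {}hup := le_trans hup (ler_wpM2l (ltW e0) up).
rewrite ler_norml; apply/andP; split; nra.
Qed.
End OneMinus.

(** * Big-O calculus at infinity *)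

Section BigO.
Context (R : realType).
Implicit Types (u v e f : nat -> R) (k n : nat).

Lemma eq_bigOP (u v e : nat -> R) : (forall n, 0 <= e n) ->
  (exists C, \forall n \near \oo, `|u n - v n| <= C * e n) -> u = v +O_\oo e.
Proof.
move=> e0 [C hC]; apply/eqaddOP.
exists C; split; first exact: num_real.
move=> K /ltW CK; apply: filterS hC => n /le_trans; apply.
by rewrite (ger0_norm (e0 n)) ler_wpM2r.
Qed.

(** With [e] constantly 1 this is eventual boundedness, the form in which bounded factors enter
    below. *)
Definition isO e u := exists C, \forall n \near \oo, `|u n| <= C * e n.

Lemma isO_le e u v :
  (\forall n \near \oo, `|v n| <= `|u n|) -> isO e u -> isO e v.
Proof.
by move=> uv [C hC]; exists C; apply: filterS2 uv hC => n; apply: le_trans.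
Qed.

Lemma isO_opp e u : isO e u -> isO e (fun n => - u n).
Proof. by apply: isO_le; apply: nearW => n; rewrite normrN. Qed.

Lemma isO_add e u v : isO e u -> isO e v -> isO e (fun n => u n + v n).
Proof.
move=> [C hC] [D hD]; exists (C + D); apply: filterS2 hC hD => n un vn.
by rewrite mulrDl; apply: le_trans (ler_normD _ _) (lerD un vn).
Qed.

Lemma isO_bmul e u v : isO (fun=> 1) u -> isO e v ->
  isO e (fun n => u n * v n).
Proof.
move=> [C hC] [D hD]; exists (C * D); apply: filterS2 hC hD => n.
by rewrite mulr1 -mulrA normrM => un vn; rewrite ler_pM.
Qed.

Lemma isO_cst (c : R) : isO (fun=> 1) (fun=> c).
Proof. by exists `|c|; apply: nearW => n; rewrite mulr1. Qed.

Lemma isO_exp u k : isO (fun=> 1) u -> isO (fun=> 1) (fun n => u n ^+ k).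
Proof.
move=> hu; elim: k => [|k IH]; first exact: isO_cst.
under [X in isO _ X]eq_fun do rewrite exprS.
exact: isO_bmul.
Qed.

Lemma isO_sum e k (u : nat -> nat -> R) :
  (forall i, (i < k)%N -> isO e (u i)) ->
  isO e (fun n => \sum_(i < k) u i n).
Proof.
elim: k => [|k IH] h.
  by exists 0; apply: nearW => n; rewrite big_ord0 normr0 mul0r.
under [X in isO _ X]eq_fun do rewrite big_ord_recr /=.
by apply: isO_add; [apply: IH => i /ltnW; exact: h | exact: h].
Qed.
End BigO.

(** * Power sums and symmetric polynomials of i / n for i < r, with r ^ 2 = O(n) *)

Section Asymptotics.
Context (R : realType) (r : nat -> nat) (K : R).
Hypothesis r_bound : \forall n \near \oo, (r n)%:R ^+ 2 <= K * n%:R.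

Let x n (i : nat) : R := i%:R / n%:R.
Let e n : R := n%:R^-1.
Let p j n := psum (x n) j (r n).
Let h k n := hsym (x n) k (r n).

Let x_ge0 n i : 0 <= x n i.
Proof. by rewrite divr_ge0. Qed.

Let p_ge0 j n : 0 <= p j n.
Proof. by apply: sumr_ge0 => i _; exact: exprn_ge0. Qed.

Let x_small : \forall n \near \oo, forall i, (i < r n)%N -> x n i <= 2 / 3.
Proof.
near=> n => i ir.
have n0 : 0 < n%:R :> R by near: n; exact: nbhs_infty_gtr.
(* This gives [i ^+ 2 <= K * n <= n ^+ 2 / 3], which is below [(2 / 3 * n) ^+ 2]. *)
have n3 : 3 * K <= n%:R by near: n; exact: nbhs_infty_ger.
have rK : (r n)%:R ^+ 2 <= K * n%:R by near: n.
have ri : i%:R <= (r n)%:R :> R by rewrite ler_nat ltnW.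
have i0 : 0 <= i%:R :> R by [].
rewrite /x ler_pdivrMr // -(ler_pXn2r (ltn0Sn 1)) ?nnegrE; last 2 first.
- by [].
- by rewrite mulr_ge0 // ltW.
nra.
Unshelve. all: by end_near. Qed.

(** Since r is of order at most the square root of n, this makes p_j of order n^((1 - j) / 2): the
    source of all the orders below. *)
Let p_le j n : p j n <= (r n)%:R * ((r n)%:R / n%:R) ^+ j.
Proof.
rewrite /p /psum; apply: le_trans (_ : \sum_(i < r n) ((r n)%:R / n%:R) ^+ j <= _).
  apply: ler_sum => i _; apply: lerXn2r; rewrite ?nnegrE ?divr_ge0 //.
  by rewrite ler_wpM2r ?invr_ge0 // ler_nat ltnW.
by rewrite sumr_const card_ord -(mulr_natl (_ ^+ j)) lexx.
Qed.

Let p_decreasing j j' : (0 < j)%N -> (j <= j')%N ->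
  \forall n \near \oo, p j' n <= p j n.
Proof.
move=> j0 jj'; apply: filterS x_small => n xs.
apply: ler_sum => i _; apply: ler_wiXn2l => //.
by apply: le_trans (xs _ (ltn_ord i)) _; lra.
Qed.

Let p1_bounded : isO (fun=> 1) (p 1).
Proof.
exists K; near=> n.
have n0 : 0 < n%:R :> R by near: n; exact: nbhs_infty_gtr.
have rK : (r n)%:R ^+ 2 <= K * n%:R by near: n.
rewrite ger0_norm ?p_ge0 // mulr1; apply: le_trans (p_le 1 n) _.
by rewrite expr1 mulrA ler_pdivrMr // -expr2.
Unshelve. all: by end_near. Qed.

Let p_bounded j : isO (fun=> 1) (p j.+1).
Proof.
apply: isO_le p1_bounded; apply: filterS (p_decreasing (ltn0Sn 0) (ltn0Sn j)) => n.
by rewrite !ger0_norm.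
Qed.

Let p2_sq : isO e (fun n => p 2 n ^+ 2).
Proof.
(* The square of p_2 is at most r^6 / n^4, hence at most (K n)^3 / n^4. *)
exists (K ^+ 3); near=> n.
have n0 : 0 < n%:R :> R by near: n; exact: nbhs_infty_gtr.
have rK : (r n)%:R ^+ 2 <= K * n%:R by near: n.
rewrite ger0_norm ?exprn_ge0 ?p_ge0 //.
apply: le_trans (_ : ((r n)%:R * ((r n)%:R / n%:R) ^+ 2) ^+ 2 <= _).
  by apply: lerXn2r (p_le 2 n); rewrite nnegrE ?p_ge0 ?mulr_ge0 ?exprn_ge0 ?divr_ge0.
rewrite (_ : _ ^+ 2 = ((r n)%:R ^+ 2) ^+ 3 / n%:R ^+ 4); last by field; lra.
rewrite (_ : _ * e n = (K * n%:R) ^+ 3 / n%:R ^+ 4); last by rewrite /e; field; lra.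
apply: ler_wpM2r; first by rewrite invr_ge0 exprn_ge0.
by apply: lerXn2r => //; rewrite nnegrE ?exprn_ge0 // (le_trans _ rK) ?exprn_ge0.
Unshelve. all: by end_near. Qed.

Let p_small j : isO e (p j.+3).
Proof.
apply: (@isO_le _ _ (p 3)).
  by apply: filterS (@p_decreasing 3 j.+3 _ _) => // n; rewrite !ger0_norm.
(* Likewise p_3 is at most r^4 / n^3, hence at most (K n)^2 / n^3. *)
exists (K ^+ 2); near=> n.
have n0 : 0 < n%:R :> R by near: n; exact: nbhs_infty_gtr.
have rK : (r n)%:R ^+ 2 <= K * n%:R by near: n.
rewrite ger0_norm ?p_ge0 //; apply: le_trans (p_le 3 n) _.
rewrite (_ : _ * _ ^+ 3 = ((r n)%:R ^+ 2) ^+ 2 / n%:R ^+ 3); last by field; lra.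
rewrite (_ : _ * e n = (K * n%:R) ^+ 2 / n%:R ^+ 3); last by rewrite /e; field; lra.
apply: ler_wpM2r; first by rewrite invr_ge0 exprn_ge0.
by apply: lerXn2r => //; rewrite nnegrE ?exprn_ge0 // (le_trans _ rK) ?exprn_ge0.
Unshelve. all: by end_near. Qed.

Let h_newton k n :
  h k.+1 n = k.+1%:R^-1 * \sum_(i < k.+1) p i.+1 n * h (k - i) n.
Proof. by rewrite -newton_hsym mulKf. Qed.

Let h_bounded k : isO (fun=> 1) (h k).
Proof.
elim/ltn_ind: k => -[_|k IH]; first exact: isO_cst.
rewrite (funext (h_newton k)).
apply: isO_bmul; first exact: isO_cst.
apply: (@isO_sum _ _ _ (fun i n => p i.+1 n * h (k - i) n)) => i ik.
apply: isO_bmul; first exact: p_bounded.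
by apply: IH; rewrite ltnS leq_subr.
Qed.

Definition poisson_weight (L : R) k : R := L ^+ k / k`!%:R.

(** The value 0 for [k < 2] lets one formula cover the three cases of the theorem. *)
Definition poisson_weight2 (L : R) k : R :=
  if k is k'.+2 then poisson_weight L k' else 0.

(** The coefficient of z^k in e^(p_1 z) (1 + p_2 z^2 / 2), a truncation of exp(sum_j p_j z^j / j),
    the generating function of the [h k n]. *)
Let a k n := poisson_weight (p 1 n) k + poisson_weight2 (p 1 n) k * (p 2 n / 2).

Let poisson_weight_bounded k :
  isO (fun=> 1) (fun n => poisson_weight (p 1 n) k).
Proof. by apply: isO_bmul; [exact: isO_exp | exact: isO_cst]. Qed.

Let poisson_weight2_bounded k :
  isO (fun=> 1) (fun n => poisson_weight2 (p 1 n) k).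
Proof.
by case: k => [|[|k]]; [exact: isO_cst | exact: isO_cst | exact: poisson_weight_bounded].
Qed.

(** Newton's recursion cut after p_2, with [poisson_weight] in place of [a k n] in the last term;
    the two differ by a multiple of p_2. *)
Let a_rec k n : k.+2%:R * a k.+2 n =
  p 1 n * a k.+1 n + p 2 n * poisson_weight (p 1 n) k.
Proof.
rewrite /a /poisson_weight2 /poisson_weight.
have f0 j : j`!%:R != 0 :> R by rewrite pnatr_eq0 -lt0n fact_gt0.
case: k => [|k]; rewrite !(factS, natrM) ?fact0 ?exprS ?expr0; field => //.
have k0 : 0 <= k%:R :> R by [].
by rewrite f0 /=; apply/and3P; split; rewrite gt_eqF //; lra.
Qed.

(** Two consecutive degrees are carried along because the recursion reaches back two steps. *)
Let h_approx k :
  isO e (fun n => h k n - a k n) /\ isO e (fun n => h k.+1 n - a k.+1 n).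
Proof.
have h0 : isO e (fun n => 0).
  by exists 0; apply: nearW => n; rewrite normr0 mul0r.
elim: k => [|k [IH0 IH1]].
  have E0 n : h 0 n - a 0 n = 0.
    by rewrite /a /h /poisson_weight /= fact0 expr0 divr1 mul0r addr0 subrr.
  have E1 n : h 1 n - a 1 n = 0.
    rewrite h_newton big_ord1 /a /h /poisson_weight /= mulr1 invr1 mul1r.
    by rewrite expr1 mulr1 mul0r addr0 subrr.
  by split; [rewrite (funext E0) | rewrite (funext E1)].
split => //.
(* Subtracting the two recursions leaves the two earlier errors with bounded factors, a multiple of
   p_2 squared, and the Newton terms from p_3 on. *)
have E n : h k.+2 n - a k.+2 n = k.+2%:R^-1 * (p 1 n * (h k.+1 n - a k.+1 n)
    + (p 2 n * (h k n - a k n)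
    + (poisson_weight2 (p 1 n) k * 2^-1 * p 2 n ^+ 2
    + \sum_(i < k) p i.+3 n * h (k.+1 - i.+2) n))).
  have -> : a k.+2 n = k.+2%:R^-1 * (k.+2%:R * a k.+2 n) by rewrite mulKf.
  rewrite h_newton a_rec !big_ord_recl /= -mulrBr; congr (_ * _).
  rewrite /bump /= !add1n subn0 subSS subn0.
  under [in LHS]eq_bigr do rewrite !add1n.
  by rewrite [a k n]/a; field.
rewrite (funext E).
apply: isO_bmul; first exact: isO_cst.
apply: isO_add; first exact: isO_bmul.
apply: isO_add; first by apply: isO_bmul => //; exact: p_bounded.
apply: isO_add.
  by apply: isO_bmul => //; apply: isO_bmul => //; exact: isO_cst.
apply: (@isO_sum _ _ _ (fun i n => p i.+3 n * h (k.+1 - i.+2) n)) => i ik.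
under [X in isO _ X]eq_fun do rewrite mulrC.
exact: isO_bmul.
Qed.

Lemma product_hsym_asymptotics k :
  isO e (fun n => (\prod_(i < r n) (1 - x n i)) * h k n -
    expR (- p 1 n) * (poisson_weight (p 1 n) k
      + (poisson_weight2 (p 1 n) k - poisson_weight (p 1 n) k) * (p 2 n / 2))).
Proof.
pose q n := \prod_(i < r n) (1 - x n i).
pose A n := expR (- p 1 n) * (1 - p 2 n / 2).
have expR_bounded : isO (fun=> 1) (fun n => expR (- p 1 n)).
  exists 1; apply: nearW => n; rewrite mulr1 ger0_norm ?expR_ge0 //.
  by rewrite -expR0 ler_expR oppr_le0.
have A_bounded : isO (fun=> 1) A.
  apply: isO_bmul => //; apply: isO_add; first exact: isO_cst.
  apply: isO_opp; under [X in isO _ X]eq_fun do rewrite mulrC.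
  by apply: isO_bmul; [exact: isO_cst | exact: p_bounded].
have q_approx : isO e (fun n => q n - A n).
  apply: isO_le (isO_add (p_small 0) p2_sq).
  apply: filterS x_small => n xs; rewrite [leRHS]ger0_norm ?addr_ge0 ?exprn_ge0 ?p_ge0 //.
  by apply: prod_one_minus_approx => i ir; rewrite x_ge0 xs.
(* The product [A n * a k n] exceeds the claimed main term only by its p_2 squared term, which has
   coefficient -1/4. *)
have E n : q n * h k n - expR (- p 1 n) * (poisson_weight (p 1 n) k
      + (poisson_weight2 (p 1 n) k - poisson_weight (p 1 n) k) * (p 2 n / 2)) =
    h k n * (q n - A n) + (A n * (h k n - a k n)
      + expR (- p 1 n) * poisson_weight2 (p 1 n) k * (- (1 / 4)) * p 2 n ^+ 2).
  by rewrite /A /a; field.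
rewrite (funext E).
apply: isO_add; first exact: isO_bmul.
apply: isO_add; first by apply: isO_bmul => //; have [] := h_approx k.
apply: isO_bmul => //; apply: isO_bmul; last exact: isO_cst.
exact: isO_bmul.
Qed.
End Asymptotics.

(** The substitution of n - i for i; it identifies [lambda] and [lambda2] with the power sums p_1
    and p_2. *)
Lemma sum_rev_ratio (R : realType) (f : R -> R) (m n : nat) : (m < n)%N ->
  \sum_(m.+1 <= i < n.+1) f (1 - i%:R / n%:R) = \sum_(i < n - m) f (i%:R / n%:R).
Proof.
move=> mn; have n0 : n%:R != 0 :> R by rewrite pnatr_eq0; lia.
rewrite big_nat_rev /= -(add0n m.+1) big_addn subSS big_mkord.
apply: eq_bigr => i _; congr f; have im := ltn_ord i.
rewrite (_ : (_ - _)%N = (n - i)%N); last lia.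
by rewrite natrB; [field | lia].
Qed.

(** A convergent sequence is eventually at most [|l| + 1] in absolute value; squaring supplies the
    constant K of the expansion. *)
Lemma square_bound_of_cvg (R : realType) (m : nat -> nat) (l : R) :
  (forall n, (2 <= n)%N -> (m n < n)%N) ->
  (n%:R - (m n)%:R) / Num.sqrt (n%:R : R) @[n --> \oo] --> l ->
  \forall n \near \oo, (n - m n)%:R ^+ 2 <= (`|l| + 1) ^+ 2 * n%:R :> R.
Proof.
move=> hm hl; near=> n.
have n2 : (2 <= n)%N by near: n; exact: nbhs_infty_ge.
have n0 : 0 < n%:R :> R by rewrite ltr0n; lia.
have : `|(n%:R - (m n)%:R) / Num.sqrt (n%:R : R)| <= `|l| + 1.
  by near: n; apply: (cvgr_norm_le _ hl); rewrite ltrDl.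
rewrite -natrB; last exact/ltnW/hm.
rewrite ger0_norm ?divr_ge0 // ler_pdivrMr ?sqrtr_gt0 // => h.
rewrite -[n%:R in leRHS](sqr_sqrtr (ltW n0)) -exprMn.
by apply: lerXn2r => //; rewrite nnegrE // mulr_ge0 // addr_ge0.
Unshelve. all: by end_near. Qed.

Theorem theorem5p3p1 (R : realType) (d : nat -> measure_display)
    (T : forall n, measurableType (d n)) (P : forall n, probability (T n) R)
    (X : forall n, nat -> {RV (P n) >-> nat})
    (hX : forall n, (2 <= n)%N -> coupon_draws n (X n))
    (lam : R) (hlam : 0 < lam)
    (m : nat -> nat) (hm : forall n, (2 <= n)%N -> (m n < n)%N)
    (hmoo : m @ \oo --> \oo)
    (hsqrt : (n%:R - (m n)%:R) / Num.sqrt (n%:R : R) @[n --> \oo]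
               --> Num.sqrt (2 * lam)) :
  let pW n k : R := fine (P n
    [set w | shifted_waiting_time R (X n) (n - m n)%N w = k%:R%:E]) in
  let lambda n : R := \sum_((m n).+1 <= i < n.+1) (1 - i%:R / n%:R) in
  let lambda2 n : R := \sum_((m n).+1 <= i < n.+1) (1 - i%:R / n%:R) ^+ 2 in
  [/\ (fun n => pW n 0%N) =
        (fun n => expR (- lambda n) - expR (- lambda n) * (lambda2 n / 2))
          +O_\oo (fun n => (n%:R : R)^-1),
      (fun n => pW n 1%N) =
        (fun n => expR (- lambda n) * lambda n - expR (- lambda n) * lambda n * (lambda2 n / 2))
          +O_\oo (fun n => (n%:R : R)^-1)
    & forall k, (2 <= k)%N ->
      (fun n => pW n k) =
        (fun n => expR (- lambda n) * (lambda n ^+ k / k`!%:R)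
           + expR (- lambda n)
             * (lambda n ^+ (k - 2) / (k - 2)`!%:R - lambda n ^+ k / k`!%:R)
             * (lambda2 n / 2))
          +O_\oo (fun n => (n%:R : R)^-1)].
Proof.
move=> pW lambda lambda2.
pose r n := (n - m n)%N.
have r_bound := square_bound_of_cvg hm hsqrt.
(* A single expansion valid for every [k]; the three claims are its instances up to algebra. *)
have expansion k : exists C, \forall n \near \oo,
    `|pW n k - expR (- lambda n) * (poisson_weight (lambda n) k
        + (poisson_weight2 (lambda n) k - poisson_weight (lambda n) k)
          * (lambda2 n / 2))| <= C * n%:R^-1.
  have [C hC] := product_hsym_asymptotics r_bound k.
  exists C; apply: filterS2 (nbhs_infty_ge 2) hC => n n2.
  have mn := hm n n2.
  rewrite /pW (@shifted_waiting_time_law _ _ _ _ n) //; last 3 first.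
  - exact: ltnW.
  - by rewrite subn_gt0.
  - exact: hX.
  rewrite /lambda (sum_rev_ratio id mn) /lambda2 (sum_rev_ratio (fun y => y ^+ 2) mn).
  by rewrite psum1.
have e_ge0 n : 0 <= (n%:R : R)^-1 by rewrite invr_ge0.
split=> [||k k2]; apply: eq_bigOP => //.
- have [C hC] := expansion 0%N; exists C; apply: filterS hC => n.
  rewrite /poisson_weight /poisson_weight2 fact0 expr0 divr1.
  by congr (`|_ - _| <= _); ring.
- have [C hC] := expansion 1%N; exists C; apply: filterS hC => n.
  rewrite /poisson_weight /poisson_weight2 factS fact0 expr1 divr1.
  by congr (`|_ - _| <= _); ring.
- have [C hC] := expansion k; exists C; apply: filterS hC => n.
  case: k k2 => [|[|k]] // _; rewrite /poisson_weight2 /poisson_weight subSS subSS subn0.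
  by congr (`|_ - _| <= _); ring.
Qed.
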